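(* Let $p$ be an odd prime, $k\ge2$ and $s>k+2$. Put $S=\sum_{j=0}^{k-1}p^j$, $A_s=2(s-1)p^{k+1}-2(s-k)+3$ and $c_s=\frac{p^{s-2-k}(p-1)}{2}$. For $0\le l<p^k$, the $p^k$-Fibonacci number of $V_{s,l}$ is as follows. (a) If $l=0$: $\mathcal M_{V_{s,l}}=c_sA_s$. (b) If $0\le i\le k-2$, $1\le t\le p-1$ and $(t-1)\sum_{\iota=i}^{k-1}p^\iota+p^i\le l\le (t-1)\sum_{\iota=i+1}^{k-1}p^\iota+p^{i+1}-1$: $\mathcal M_{V_{s,l}}=c_s\big(A_s+2tS-2\sum_{\mu=0}^{k-i-2}p^\mu\big)$ if $1\le t\le\frac{p-1}{2}$, and $\mathcal M_{V_{s,l}}=c_s\big(A_s+(2t-2p)S-2\sum_{\mu=0}^{k-i-2}p^\mu\big)$ if $\frac{p+1}{2}\le t\le p-1$. (c) If $1\le t\le p-1$, $t\ne\frac{p-1}{2}$, and $tp^{k-1}\le l\le tS$: $\mathcal M_{V_{s,l}}=c_s(A_s+2tS)$ if $1\le t\le\frac{p-3}{2}$, and $\mathcal M_{V_{s,l}}=c_s(A_s+(2t-2p)S)$ if $\frac{p+1}{2}\le t\le p-1$. (d) If $1\le i'\le k-1$ and $\frac{p-1}{2}\sum_{\iota=i'}^{k-1}p^\iota\le l\le\frac{p-1}{2}\sum_{\iota=i'-1}^{k-1}p^\iota-1$: $\mathcal M_{V_{s,l}}=c_s\Big(A_s-p^k-2\sum_{\theta=1}^{k-1}p^\theta+2\sum_{\mu=k-i'+1}^{k}p^\mu-1\Big)$.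 (e) If $l=\frac{p-1}{2}S$: $\mathcal M_{V_{s,l}}=c_s\Big(A_s-p^k-2\sum_{\theta=1}^{k-1}p^\theta-1\Big)$.
   Context: Fix an odd prime $p$ and an integer $k\ge 0$. For integers $0\le i<n$ write $\lambda(n,i)=(n-i,1^i)$ for the hook partition of $n$ with $n-i$ boxes in its first row and $i$ further boxes in its first column. If $\mu=\lambda(n',i')$ is obtained from $\lambda(n,i)$ by appending $m=(n'-i')-(n-i)\ge 0$ boxes to the first row and $n''=i'-i\ge 0$ boxes to the first column, we say $\mu$ is obtained by adding the block $B_{m,n''}$ ($m$ horizontal nodes, $n''$ vertical nodes). Put $x_s=p^k(sp-(s+1))$. The relevant part (''column $k$'') of the $p$-Bratteli diagram is the graded directed graph with vertices: on floor $2k+1$, $S_i=\lambda(p^k(p-1),i)$ for $0\le i<p^k(p-1)$; on floor $2(k+s)$ ($s\ge1$), $V_{s,l}=\lambda\big(p^k(2sp-(2s+1)),\,x_s+l\big)$ for $0\le l<p^k$; on floor $2(k+s)-1$ ($s\ge2$), $W_{s,l'}=\lambda\big(p^k((2s-1)p-2s),\,x_{s-1}+l'\big)$ for $0\le l'<p^{k+1}$; and edges, each labelled by the block added: (E1) $S_i\to V_{1,l}$ exactly when $i=p^kt+l$ with $0\le t\le p-2$, block $B_{p^kt,\,p^k(p-2-t)}$; (E2) for $s\ge2$, $0\le l<p^k$, $0\le\beta\le p-1$: $V_{s-1,l}\to W_{s,pl+\beta}$, block $B_{p^k(p-1)-((p-1)l+\beta),\,(p-1)l+\beta}$; (E3)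 for $s\ge 2$, $0\le l'<p^{k+1}$ and $t=\lfloor l'/p^k\rfloor$: $W_{s,l'}\to V_{s,l'-p^kt}$, block $B_{p^kt,\,p^k(p-1-t)}$. A path ending at a vertex $v$ is a sequence of edges starting at some $S_i$ and going up one floor at a time to $v$ ($S_i\to V_{1,\cdot}\to W_{2,\cdot}\to V_{2,\cdot}\to W_{3,\cdot}\to\cdots\to v$); $\mathcal P(v)$ is the set of all paths ending at $v$. The blocks of a path are numbered $B^2,B^3,\dots,B^N$: $B^2$ is the block of the edge leaving $S_i$, and for $j\ge2$, $B^{2j-1}$ is the block of the edge into $W_{j,\cdot}$ and $B^{2j}$ the block of the edge into $V_{j,\cdot}$. Write $B^j=B_{m_j,n_j}$. Descents: $1\in\mathrm{Des}(P)$ iff $m_2=p^kt$ with $0\le t<\frac{p-1}{2}$; $2\notin\mathrm{Des}(P)$; for $3\le j<N$, $j\in\mathrm{Des}(P)$ iff $m_j>m_{j+1}$ and $n_j<n_{j+1}$. $\mathrm{des}(P)=|\mathrm{Des}(P)|$. The $p^k$-Fibonacci number of a vertex $v$ is $\mathcal M_v=\sum_{P\in\mathcal P(v)}\mathrm{des}(P)$. *)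

(* Defs.v *)
From mathcomp Require Import all_boot.
Set Implicit Arguments. Unset Strict Implicit. Unset Printing Implicit Defensive.

(* Column k of the p-Bratteli diagram (p odd prime, k >= 0 are parameters). *)

(* Vertices: S i (floor 2k+1), V s l (floor 2(k+s)), W s l' (floor 2(k+s)-1). *)
Inductive vertex := S of nat | V of nat & nat | W of nat & nat.

(* A block B_{m,n} is encoded as the pair (m, n). *)
Definition block := (nat * nat)%type.

Definition edge_block (p k : nat) (u v : vertex) : option block :=
  match u, v with
  | S i, V s l =>
      let t := i %/ p ^ k in
      if [&& s == 1, i < p ^ k * (p - 1), l < p ^ k, i == p ^ k * t + l
           & t <= p - 2]
      then Some (p ^ k * t, p ^ k * (p - 2 - t)) else None
  | V s0 l, W s l' =>
      let beta := l' %% p in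
      if [&& 2 <= s, s0 == s.-1, l < p ^ k, l' < p ^ k.+1 & l' == p * l + beta]
      then Some (p ^ k * (p - 1) - ((p - 1) * l + beta), (p - 1) * l + beta)
      else None
  | W s l', V s0 l =>
      let t := l' %/ p ^ k in
      if [&& 2 <= s, s0 == s, l' < p ^ k.+1, l < p ^ k & l == l' - p ^ k * t]
      then Some (p ^ k * t, p ^ k * (p - 1 - t)) else None
  | _, _ => None
  end.

Definition is_edge p k u v : bool := edge_block p k u v.

Definition preds (p k : nat) (v : vertex) : seq vertex :=
  match v with
  | S _ => [::]
  | V s l =>
      if s == 1 then [seq S i | i <- iota 0 (p ^ k * (p - 1)) & is_edge p k (S i) v]
      else [seq W s l' | l' <- iota 0 (p ^ k.+1) & is_edge p k (W s l') v]
  | W s l' => [seq V s.-1 l0 | l0 <- iota 0 (p ^ k) & is_edge p k (V s.-1 l0) v]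
  end.

(* Number of floors between the S-floor and the vertex. *)
Definition height (v : vertex) : nat :=
  match v with S _ => 0 | V s _ => (2 * s).-1 | W s _ => (2 * s).-2 end.

Fixpoint paths_n (p k : nat) (n : nat) (v : vertex) : seq (seq vertex) :=
  match n with
  | 0 => if v is S _ then [:: [:: v]] else [::]
  | n'.+1 => flatten [seq [seq rcons P v | P <- paths_n p k n' u] | u <- preds p k v]
  end.

Definition paths (p k : nat) (v : vertex) : seq (seq vertex) :=
  paths_n p k (height v) v.

(* The blocks B^2, ..., B^N of a path. *)
Definition blocks (p k : nat) (P : seq vertex) : seq block :=
  match P with
  | [::] => [::]
  | x :: P' => pairmap (fun u v => odflt (0, 0) (edge_block p k u v)) x P'
  end.

Definition des (p k : nat) (P : seq vertex) : nat :=
  let bs := blocks p k P in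
  let N := (size bs).+1 in
  let B j := nth (0, 0) bs (j - 2) in
  let d1 := (p ^ k %| (B 2).1) && ((B 2).1 %/ p ^ k < (p - 1) %/ 2) in
  d1 + \sum_(3 <= j < N) (((B j.+1).1 < (B j).1) && ((B j).2 < (B j.+1).2)).

Definition Mfib (p k : nat) (v : vertex) : nat :=
  \sum_(P <- paths p k v) des p k P.

(* Main.v *)
Require Import Defs.
From mathcomp Require Import all_boot all_order all_algebra.
From mathcomp Require Import zify ring.
Import GRing.Theory Num.Theory.
Set Implicit Arguments. Unset Strict Implicit. Unset Printing Implicit Defensive.

(* Read the index of a vertex in base p.  A step V_{s-1,u} -> W_{s,w} -> V_{s,l}
   appends a digit to the k-digit word u, giving the (k+1)-digit word w, and then
   drops the leading digit, leaving l; a path is thus a sliding window over a word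
   of digits.  Both kinds of descents compare w with a repdigit: with R the
   (k+1)-digit repunit, W_{s,w} -> V_{s,l} creates a descent iff w < (p-1)/2 R, and
   entering W_{s,w} after having dropped the digit t creates one iff (p-1-t) R < w.
   Summing over the dropped digit expresses M_{V_{s,l}} through the averaging
   operator (T f)(l) = sum_t f((p^k t + l) %/ p).  Let u_j be the number formed by
   the j leading digits of l and R_j the j-digit repunit.  With
   x_j = 2 [u_j < (p-1)/2 R_j] - 1 and n_j = 2 #{e < p | e R_j < u_j} - p one has
   T x_(j+1) = x_j and T n_(j+1) = n_j, while x_0 and n_0 are constant, so iterating
   T gives a closed form for M_{V_{s,l}}.  The five cases of the theorem are the
   possible values of the x_j and n_j. *)

(** * Repunits and the repdigit thresholds of [w - w %/ p] *)

Definition repunit (p n : nat) := \sum_(0 <= i < n) p ^ i.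

Lemma repunitS p n : repunit p n.+1 = repunit p n + p ^ n.
Proof. by rewrite /repunit big_nat_recr. Qed.

Lemma repunit_pred p n : 0 < p -> (p - 1) * repunit p n + 1 = p ^ n.
Proof.
move=> p0; elim: n => [|n IH]; first by rewrite /repunit big_nil muln0.
rewrite repunitS expnS mulnDr -addnA [_ * p ^ n + 1]addnC addnA IH.
by rewrite mulnBl mul1n addnC subnK // leq_pmull.
Qed.

Lemma repunitSl p n : repunit p n.+1 = p * repunit p n + 1.
Proof.
elim: n => [|n IH]; first by rewrite repunitS /repunit big_nil muln0.
by rewrite [LHS]repunitS {1}IH repunitS expnS; lia.
Qed.

Lemma repunit_lt p e n : e < p -> e * repunit p n < p ^ n.
Proof. by move=> ep; rewrite -(@repunit_pred p n) //; nia. Qed.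

Lemma sum_shift_repunit p i k : i <= k ->
  \sum_(i <= j < k) p ^ j = p ^ i * repunit p (k - i).
Proof.
move=> ik; rewrite -{1}[i]add0n big_addn /repunit big_distrr /=.
by apply: eq_bigr => j _; rewrite expnD mulnC.
Qed.

(* [w - w %/ p] is the number of vertical nodes of the block into [W s w]; its
   thresholds are the (k+1)-digit repdigits in base p. *)
Lemma vert_lt_repdigit p k e w : 0 < p -> e < p ->
  (w - w %/ p < p ^ k * e) = (w < e * repunit p k.+1).
Proof.
move=> p0 ep; have := ltn_pmod w p0; have := divn_eq w p.
move: (w %/ p) (w %% p) => q b -> bp.
rewrite -(repunit_pred k p0) repunitSl.
case: p p0 ep bp => // d _ ep bp; rewrite subn1 /=.
have -> : q * d.+1 + b - q = d * q + b by nia.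
have -> : (d * repunit d.+1 k + 1) * e = d * (e * repunit d.+1 k) + e by lia.
have -> : e * (d.+1 * repunit d.+1 k + 1) = d.+1 * (e * repunit d.+1 k) + e by lia.
(* [w - w %/ p] takes the same value at a multiple of p and just before it; a last digit e > 0 keeps
   the repdigit away from such a multiple. *)
have [->|e0] := posnP e; first by rewrite !mul0n !muln0.
move: (e * _) => x; case: (ltngtP q x) => [qx|xq|->]; last by apply/idP/idP; lia.
  by have [y ->] : exists y, x = q + y.+1 by [exists (x - q.+1); lia|]; nia.
by have [y ->] : exists y, q = x + y.+1 by [exists (q - x.+1); lia|]; nia.
Qed.

(** The map [w - w %/ p] is nondecreasing and stalls only when the last digit passes from p-1 to 0.
    A stall just above the repdigit thus needs e = p-1; then the repdigit is p^(k+1)-1, and the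
    bound on w leaves nothing above it. *)
Lemma vert_gt_repdigit p k e w : 0 < p -> e < p -> w < p ^ k.+1 ->
  (p ^ k * e < w - w %/ p) = (e * repunit p k.+1 < w).
Proof.
move=> p0 ep; have := ltn_pmod w p0; have := divn_eq w p.
move: (w %/ p) (w %% p) => q b -> bp.
rewrite -(repunit_pred k p0) -(repunit_pred k.+1 p0) repunitSl.
case: p p0 ep bp => // d _ ep bp; rewrite subn1 /=.
have -> : q * d.+1 + b - q = d * q + b by nia.
have -> : (d * repunit d.+1 k + 1) * e = d * (e * repunit d.+1 k) + e by lia.
have -> : e * (d.+1 * repunit d.+1 k + 1) = d.+1 * (e * repunit d.+1 k) + e by lia.
have -> : d * (d.+1 * repunit d.+1 k + 1) = d.+1 * (d * repunit d.+1 k) + d by lia.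
move: (repunit _ _) => r wr.
have qr : e = d -> q <= e * r by move=> ->; nia.
move: (e * r) qr => x qx; case: (ltngtP q x) => [qx'|xq|->]; last by apply/idP/idP; lia.
  by have [y ->] : exists y, x = q + y.+1 by [exists (x - q.+1); lia|]; nia.
have ed : e < d by rewrite ltn_neqAle -ltnS ep andbT; apply/eqP => /qx; lia.
by have [y ->] : exists y, q = x + y.+1 by [exists (q - x.+1); lia|]; nia.
Qed.

(** * Counting leading digits by comparison with a repdigit *)

Lemma sum_ord_lt n e : e <= n -> \sum_(t < n) (t < e : nat) = e.
Proof.
move=> en; rewrite -(big_mkord predT (fun t => (t < e : nat))).
rewrite (big_cat_nat (leq0n e) en) /= big_nat_cond (eq_bigr (fun=> 1)) => [|i]; last by case: ltnP; rewrite ?andbF.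
rewrite -big_nat_cond sum_nat_const_nat muln1 subn0.
rewrite big_nat_cond big1 ?addn0 // => i /andP[/andP[ei _] _].
by rewrite ltnNge ei.
Qed.

Lemma sum_ord_gt n e : e < n -> \sum_(t < n) (e < t : nat) = n - e.+1.
Proof.
move=> en; have : \sum_(t < n) ((e < t : nat) + (t < e.+1)) = n.
  rewrite (eq_bigr (fun=> 1)) ?sum_nat_const ?card_ord ?muln1 // => t _.
  by rewrite ltnS; case: ltnP.
by rewrite big_split /= sum_ord_lt //; lia.
Qed.

Lemma sum_ord_eq n e (c : nat) : e < n -> \sum_(t < n) (t == e :> nat) * c = c.
Proof.
move=> en; rewrite (bigD1 (Ordinal en)) //= eqxx mul1n big1 ?addn0 // => t.
by rewrite -val_eqE /= => /negbTE ->.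
Qed.

(** The leading digit t decides the comparison unless t = e, when it passes to the remaining j
    digits u. *)
Lemma sum_lt_repdigit p e j u : e < p -> u < p ^ j ->
  \sum_(t < p) (p ^ j * t + u < e * repunit p j.+1 : nat) = e + (u < e * repunit p j).
Proof.
move=> ep uj; rewrite -{2}(sum_ord_lt (ltnW ep)) -(sum_ord_eq (u < _) ep) -big_split /=.
apply: eq_bigr => t _; rewrite repunitS; have := repunit_lt j ep.
move: (repunit p j) (p ^ j) uj => r P uP er.
case: (ltngtP t e) => te /=; last by rewrite te; case: (u < _) / idP; lia.
  by rewrite mul0n; apply/eqP; rewrite eqb1; nia.
by rewrite mul0n; apply/eqP; rewrite eqb0; nia.
Qed.

Lemma sum_gt_repdigit p e j u : e < p -> u < p ^ j ->
  \sum_(t < p) (e * repunit p j.+1 < p ^ j * t + u : nat) = p - e.+1 + (e * repunit p j < u).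
Proof.
move=> ep uj; rewrite -(sum_ord_gt ep) -(sum_ord_eq (_ < u) ep) -big_split /=.
apply: eq_bigr => t _; rewrite repunitS; have := repunit_lt j ep.
move: (repunit p j) (p ^ j) uj => r P uP er.
case: (ltngtP t e) => te /=; last by rewrite te; case: (_ < u) / idP; lia.
  by rewrite mul0n; apply/eqP; rewrite eqb0; nia.
by rewrite mul0n; apply/eqP; rewrite eqb1; nia.
Qed.

(** * Sums over paths as iterated sums over the dropped digit *)

Lemma sum_paths_n p k n v (F : seq vertex -> nat) :
  \sum_(P <- paths_n p k n.+1 v) F P =
  \sum_(u <- preds p k v) \sum_(P <- paths_n p k n u) F (rcons P v).
Proof.
rewrite /= big_flatten big_map; apply: eq_bigr => u _.
by rewrite big_map.
Qed.

Lemma sum_preds_V p k s l (G : vertex -> nat) : 0 < p -> 1 < s -> l < p ^ k ->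
  \sum_(u <- preds p k (V s l)) G u = \sum_(t < p) G (W s (p ^ k * t + l)).
Proof.
move=> p0 s1 lk; rewrite /= gtn_eqF // big_map.
rewrite -(big_mkord predT (fun t => G (W s (p ^ k * t + l)))) /index_iota subn0.
rewrite -(big_map (fun t => p ^ k * t + l) predT (fun w => G (W s w))).
apply: perm_big; apply: uniq_perm.
- by rewrite filter_uniq ?iota_uniq.
- rewrite map_inj_uniq ?iota_uniq // => t u /addIn /eqP.
  by rewrite eqn_pmul2l ?expn_gt0 ?p0 // => /eqP.
move=> w; rewrite mem_filter mem_iota /= add0n /is_edge /edge_block /= s1 eqxx lk /=.
apply/andP/mapP => [[] | [t]].
  case: ifP => // /andP[_ /eqP lE] _ wk; exists (w %/ p ^ k).
    by rewrite mem_iota /= add0n ltn_divLR ?expn_gt0 ?p0 // -expnS.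
  by rewrite lE addnC subnK // mulnC leq_trunc_div.
rewrite mem_iota /= add0n => tp ->.
have pk : 0 < p ^ k by rewrite expn_gt0 p0.
have wk : p ^ k * t + l < p ^ k.+1 by rewrite expnS; nia.
rewrite wk mulnC divnMDl // divn_small // addn0 mulnC.
by rewrite addKn eqxx.
Qed.

Lemma sum_preds_W p k s w (G : vertex -> nat) : 0 < p -> 1 < s -> w < p ^ k.+1 ->
  \sum_(u <- preds p k (W s w)) G u = G (V s.-1 (w %/ p)).
Proof.
move=> p0 s1 wk; rewrite /= big_map.
rewrite -[RHS](@big_seq1 _ 0 addn _ (w %/ p) (fun l => G (V s.-1 l))).
apply: perm_big; apply: uniq_perm; rewrite ?filter_uniq ?iota_uniq // => l.
rewrite mem_filter mem_iota mem_seq1 /= add0n /is_edge /edge_block /= s1 eqxx wk /=.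
apply/andP/eqP => [[] | ->].
  case: ifP => // /andP[_ /eqP ->] _ _.
  by rewrite mulnC divnMDl // divn_small ?addn0 // ltn_pmod.
have lk : w %/ p < p ^ k by rewrite ltn_divLR // mulnC -expnS.
by rewrite lk mulnC -divn_eq eqxx.
Qed.

Lemma window_lt p k t l : t < p -> l < p ^ k -> p ^ k * t + l < p ^ k.+1.
Proof. by move=> tp lk; rewrite expnS; nia. Qed.

Lemma window_div_lt p k t l : t < p -> l < p ^ k -> (p ^ k * t + l) %/ p < p ^ k.
Proof.
move=> tp lk; rewrite ltn_divLR ?(leq_ltn_trans _ tp) // -expnSr.
exact: window_lt.
Qed.

Lemma sum_paths_VS p k s l (F : seq vertex -> nat) :
  0 < p -> 0 < s -> l < p ^ k ->
  \sum_(P <- paths p k (V s.+1 l)) F P =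
  \sum_(t < p) \sum_(P <- paths p k (V s ((p ^ k * t + l) %/ p)))
    F (rcons (rcons P (W s.+1 (p ^ k * t + l))) (V s.+1 l)).
Proof.
move=> p0 s0 lk; rewrite /paths.
have -> : height (V s.+1 l) = (height (V s l)).+2 by rewrite /=; lia.
rewrite sum_paths_n sum_preds_V //; apply: eq_bigr => t _.
by rewrite sum_paths_n sum_preds_W // window_lt.
Qed.

Lemma sum_paths_V1 p k l (F : seq vertex -> nat) : 0 < p -> l < p ^ k ->
  \sum_(P <- paths p k (V 1 l)) F P =
  \sum_(t < p - 1) F [:: S (p ^ k * t + l); V 1 l].
Proof.
move=> p0 lk; rewrite /paths [height _]/= sum_paths_n /= big_map.
rewrite -(big_mkord predT (fun t => F [:: S (p ^ k * t + l); V 1 l])) /index_iota subn0.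
rewrite -(big_map (fun t => p ^ k * t + l) predT (fun w => F [:: S w; V 1 l])).
rewrite (eq_bigr (fun i => F [:: S i; V 1 l])) => [|i _]; last by rewrite big_seq1.
have pk : 0 < p ^ k by rewrite expn_gt0 p0.
apply: perm_big; apply: uniq_perm.
- by rewrite filter_uniq ?iota_uniq.
- rewrite map_inj_uniq ?iota_uniq // => t u /addIn /eqP.
  by rewrite eqn_pmul2l // => /eqP.
move=> w; rewrite mem_filter mem_iota /= add0n /is_edge /edge_block /= lk /=.
apply/andP/mapP => [[] | [t]].
  case: ifP => // /and3P[wk /eqP lE _] _ _; exists (w %/ p ^ k) => //.
  by rewrite mem_iota /= add0n ltn_divLR // mulnC.
rewrite mem_iota /= add0n => tp ->.
rewrite mulnC divnMDl // divn_small // addn0 mulnC eqxx.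
have -> : p ^ k * t + l < p ^ k * (p - 1) by nia.
by have -> : t <= p - 2 by lia.
Qed.

(** There are p-1 choices at the bottom and p dropped digits in each later round, whatever l is. *)
Lemma size_paths p k s l : 0 < p -> 0 < s -> l < p ^ k ->
  size (paths p k (V s l)) = (p - 1) * p ^ s.-1.
Proof.
move=> p0; rewrite -sum1_size; elim: s l => // -[|s] IH l _ lk.
  by rewrite sum_paths_V1 // sum_nat_const card_ord expn0.
rewrite sum_paths_VS // (eq_bigr (fun=> (p - 1) * p ^ s)) => [|t _].
  by rewrite sum_nat_const card_ord /= expnS mulnCA.
by rewrite IH // window_div_lt.
Qed.

(* [vertex] carries no [eqType], so the shape of the members of [paths] is
   expressed by congruence of sums. *)
Lemma eq_sum_paths p k s l (F G : seq vertex -> nat) : 0 < p -> 0 < s -> l < p ^ k ->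
  (forall P, size P = (2 * s).-1 -> F (rcons P (V s l)) = G (rcons P (V s l))) ->
  \sum_(P <- paths p k (V s l)) F P = \sum_(P <- paths p k (V s l)) G P.
Proof.
move=> p0; elim: s l F G => // -[|s] IH l F G _ lk FG.
  rewrite !sum_paths_V1 //; apply: eq_bigr => t _.
  exact: (FG [:: _]).
rewrite !sum_paths_VS //; apply: eq_bigr => t _.
apply: IH => // [|P sP]; first exact: window_div_lt.
by apply: FG; rewrite !size_rcons sP; lia.
Qed.

(** * Descents between consecutive blocks *)

Definition descent (b c : block) : bool := (c.1 < b.1) && (b.2 < c.2).

(** Entry i is the block B^(i+2); the sum starts at i = 1 because 2 is never a descent. *)
Definition des_blocks (p k : nat) (bs : seq block) : nat :=
  ((p ^ k %| (nth (0, 0) bs 0).1) && ((nth (0, 0) bs 0).1 %/ p ^ k < (p - 1) %/ 2)) +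
  \sum_(1 <= i < (size bs).-1) descent (nth (0, 0) bs i) (nth (0, 0) bs i.+1).

Lemma desE p k P : des p k P = des_blocks p k (blocks p k P).
Proof.
rewrite /des /des_blocks; congr (_ + _).
rewrite -[3]/(1 + 2) big_addn.
have -> : (size (blocks p k P)).+1 - 2 = (size (blocks p k P)).-1 by lia.
apply: eq_big_nat => i _.
by rewrite /descent -addSn !addnK.
Qed.

(** The guard covers the case where [bs] is B^2 alone: the new pair then sits at position 2, which
    never counts. *)
Lemma des_blocks_rcons p k bs b : 0 < size bs ->
  des_blocks p k (rcons bs b) =
  des_blocks p k bs + (1 < size bs) * descent (last (0, 0) bs) b.
Proof.
move=> bs0; rewrite /des_blocks size_rcons /= !nth_rcons bs0 -addnA; congr (_ + _).
case: ltnP => bs1; last first.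
  by rewrite !big_geq //; case: (size bs) bs1 bs0 => [|[|?]].
rewrite -{1}(ltn_predK bs0) big_nat_recr /=; last by rewrite -ltnS (ltn_predK bs0).
rewrite mul1n; congr (_ + _).
  apply: eq_big_nat => i /andP[_ ib].
  by have i1 : i.+1 < size bs by [lia|]; rewrite !nth_rcons i1 (ltnW i1).
rewrite !nth_rcons (ltn_predK bs0) ltnn eqxx ifT ?ltn_predL //.
by rewrite nth_last.
Qed.

Lemma blocks_rcons p k P u v :
  blocks p k (rcons (rcons P u) v) =
  rcons (blocks p k (rcons P u)) (odflt (0, 0) (edge_block p k u v)).
Proof.
case: P => [//|x P] /=.
by rewrite -[rcons (rcons P u) v]cats1 pairmap_cat /= last_rcons cats1.
Qed.

Lemma size_blocks p k P : size (blocks p k P) = (size P).-1.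
Proof. by case: P => //= x P; rewrite size_pairmap. Qed.

(** The edge labels into and out of [W s w] as functions of the word w alone, which makes descents
    independent of the floor. *)
Definition blockW (p k w : nat) : block :=
  (p ^ k * (p - 1) - (w - w %/ p), w - w %/ p).

Definition blockV (p k w : nat) : block :=
  (p ^ k * (w %/ p ^ k), p ^ k * (p - 1 - w %/ p ^ k)).

Lemma edge_blockW p k s w : 0 < p -> 0 < s -> w < p ^ k.+1 ->
  edge_block p k (V s (w %/ p)) (W s.+1 w) = Some (blockW p k w).
Proof.
move=> p0 s0 wk; rewrite /edge_block /= ltnS s0 eqxx wk ltn_divLR //.
rewrite -expnSr wk mulnC -divn_eq eqxx /= /blockW.
have -> // : (p - 1) * (w %/ p) + w %% p = w - w %/ p.
rewrite {3}(divn_eq w p); nia.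
Qed.

Lemma edge_blockV p k s w : 0 < p -> 0 < s -> w < p ^ k.+1 ->
  edge_block p k (W s.+1 w) (V s.+1 (w %% p ^ k)) = Some (blockV p k w).
Proof.
move=> p0 s0 wk; rewrite /edge_block /= ltnS s0 eqxx wk ltn_mod expn_gt0 p0 /=.
have -> : w - p ^ k * (w %/ p ^ k) = w %% p ^ k.
  by rewrite {1}(divn_eq w (p ^ k)) mulnC addKn.
by rewrite eqxx.
Qed.

(** Both blocks have p^k(p-1) nodes, so the two inequalities of a descent are equivalent. They say w
    < (p-1-t)R, with t the leading digit of w and R the (k+1)-digit repunit. *)
Lemma descent_WV p k w : odd p -> 1 < p -> w < p ^ k.+1 ->
  descent (blockW p k w) (blockV p k w) = (w < (p - 1) %/ 2 * repunit p k.+1).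
Proof.
move=> p_odd p1 wk; have p0 := ltnW p1.
have pk : 0 < p ^ k by rewrite expn_gt0 p0.
have tp : w %/ p ^ k < p by rewrite ltn_divLR // -expnS.
transitivity (w < (p - 1 - w %/ p ^ k) * repunit p k.+1).
  rewrite -vert_lt_repdigit //; last by move: (_ %/ _) => t; lia.
  rewrite /descent /= !mulnBr muln1; move: (w - _) (p ^ k * _) (p ^ k * _) => a x y.
  apply/andP/idP => [[]|]; lia.
have wt := divn_eq w (p ^ k); have := ltn_pmod w pk.
move: (w %/ p ^ k) (w %% p ^ k) tp wt => t r tp -> rk.
have h2 : p - 1 = 2 * ((p - 1) %/ 2) by lia.
have := @repunit_lt p ((p - 1) %/ 2) k; move: ((p - 1) %/ 2) h2 => h h2.
rewrite h2 repunitS => /(_ ltac:(lia)).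
move: (repunit p k) (p ^ k) rk => R K rk hR.
(* With p-1 = 2h, replacing p-1-t by h is harmless: both comparisons hold if t < h, both fail if t >
   h, and they coincide if t = h. *)
have [th|ht|->] := ltngtP t h; last by have -> : 2 * h - h = h by lia.
  have -> : t * K + r < (2 * h - t) * (R + K) by nia.
  by apply/esym; nia.
have -> : (t * K + r < h * (R + K)) = false by nia.
by nia.
Qed.

Lemma descent_VW p k u w : 1 < p -> u < p ^ k.+1 -> w < p ^ k.+1 ->
  descent (blockV p k u) (blockW p k w) = ((p - 1 - u %/ p ^ k) * repunit p k.+1 < w).
Proof.
move=> p1 uk wk; have p0 := ltnW p1.
have tp : u %/ p ^ k < p by rewrite ltn_divLR ?expn_gt0 ?p0 // -expnS.
rewrite -vert_gt_repdigit //; last by move: (_ %/ _) => t; lia.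
(* This bound makes the truncated subtraction in [blockW] exact. *)
have ap : w - w %/ p <= p ^ k * (p - 1).
  move: wk; rewrite expnSr {1 2}(divn_eq w p); have := ltn_pmod w p0.
  move: (w %/ p) (w %% p) (p ^ k) => q b K; nia.
rewrite /descent /=; move: ap (u %/ _) tp; rewrite !mulnBr muln1.
move: (w - _) => a; nia.
Qed.

(** * The recursion for the Fibonacci numbers *)

Lemma half_pred_lt p : 1 < p -> (p - 1) %/ 2 < p.
Proof. by lia. Qed.

Lemma Mfib_V1 p k l : 1 < p -> l < p ^ k -> Mfib p k (V 1 l) = (p - 1) %/ 2.
Proof.
move=> p1 lk; have p0 := ltnW p1.
have pk : 0 < p ^ k by rewrite expn_gt0 p0.
rewrite /Mfib sum_paths_V1 // -[RHS](@sum_ord_lt (p - 1)) ?leq_div //.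
apply: eq_bigr => t _; rewrite desE /des_blocks /= big_geq // addn0.
have tE : (p ^ k * t + l) %/ p ^ k = t.
  by rewrite mulnC divnMDl // divn_small // addn0.
rewrite lk tE eqxx; have := ltn_ord t => tp.
have -> : p ^ k * t + l < p ^ k * (p - 1) by nia.
have -> : t <= p - 2 by lia.
by rewrite /= dvdn_mulr // mulKn.
Qed.

(** The last block depends only on the digit dropped last, and each digit is dropped by equally many
    paths; hence no dependence on l. *)
Lemma sum_descent_last p k s l w : 1 < p -> 1 < s -> l < p ^ k -> w < p ^ k.+1 ->
  \sum_(P <- paths p k (V s l)) descent (last (0, 0) (blocks p k P)) (blockW p k w) =
  (p - 1) * p ^ (s - 2) * \sum_(e < p) (e * repunit p k.+1 < w).
Proof.
move=> p1; case: s => [|[|s]] // _ lk wk; have p0 := ltnW p1.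
have pk : 0 < p ^ k by rewrite expn_gt0 p0.
(* Passing to the complementary digit turns the threshold p-1-e into t. *)
rewrite sum_paths_VS // !subSS subn0 big_distrr /= (reindex_inj rev_ord_inj) /=.
apply: eq_bigr => t _; set e := p - t.+1.
have ep : e < p by rewrite /e; lia.
have vk := window_lt ep lk.
rewrite (eq_bigr (fun=> (t * repunit p k.+1 < w) : nat)).
  rewrite big_const_seq count_predT iter_addn_0 size_paths ?window_div_lt //.
  by rewrite mulnC.
move=> P _; rewrite blocks_rcons last_rcons.
have lE : l = (p ^ k * e + l) %% p ^ k by rewrite mulnC modnMDl modn_small.
rewrite {2}lE edge_blockV //= descent_VW //.
rewrite [p ^ k * e]mulnC divnMDl // divn_small // addn0.
by rewrite /e; have -> : p - 1 - (p - t.+1) = t by have := ltn_ord t; lia.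
Qed.

(** A round appends two blocks and so two possible descents: the indicator is the one between them,
    the guarded sum the one before them. *)
Lemma Mfib_VS p k s l : odd p -> 1 < p -> 0 < s -> l < p ^ k ->
  Mfib p k (V s.+1 l) = \sum_(t < p)
    (Mfib p k (V s ((p ^ k * t + l) %/ p))
     + (p - 1) * p ^ s.-1 * (p ^ k * t + l < (p - 1) %/ 2 * repunit p k.+1)
     + (1 < s) * ((p - 1) * p ^ (s - 2)
                  * \sum_(e < p) (e * repunit p k.+1 < p ^ k * t + l))).
Proof.
move=> p_odd p1 s0 lk; have p0 := ltnW p1.
rewrite /Mfib sum_paths_VS //; apply: eq_bigr => t _.
have wk := window_lt (ltn_ord t) lk; have uk := window_div_lt (ltn_ord t) lk.
have lE : l = (p ^ k * t + l) %% p ^ k by rewrite mulnC modnMDl modn_small.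
move: (p ^ k * t + l) lE wk uk => w -> wk uk.
rewrite (@eq_sum_paths _ _ _ _ _ (fun P => des p k P +
    (1 < s) * descent (last (0, 0) (blocks p k P)) (blockW p k w) +
    (w < (p - 1) %/ 2 * repunit p k.+1))) //; last first.
  move=> P sP; rewrite desE !blocks_rcons edge_blockW // edge_blockV //=.
  rewrite !des_blocks_rcons ?size_rcons ?size_blocks ?size_rcons ?sP //=; try by lia.
  rewrite last_rcons descent_WV // -desE.
  (* A path to [V s] has 2s-1 blocks, so only s = 1 leaves B^2 alone. *)
  have -> : (1 < (2 * s).-1) = (1 < s) by lia.
  have -> : 1 < (2 * s).-1.+1 by lia.
  by rewrite mul1n.
rewrite !big_split /= addnAC; congr (_ + _ + _).
  by rewrite big_const_seq count_predT iter_addn_0 size_paths // mulnC.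
rewrite -big_distrr /=; case: ltnP => // s1; rewrite !mul1n.
exact: sum_descent_last.
Qed.

(** * The averaging operator on leading-digit statistics *)

Local Open Scope ring_scope.

(* The normalisation that makes the averaging operator
   [f |-> (fun l => \sum_(t < p) f ((p ^ k * t + l) %/ p))] act as the shift
   [j.+1 |-> j] on both families. *)
Definition xi p k j l : int :=
  2 * ((l %/ p ^ (k - j) < (p - 1) %/ 2 * repunit p j)%N : nat)%:Z - 1.
Definition nu p k j l : int :=
  2 * (\sum_(e < p) (e * repunit p j < l %/ p ^ (k - j))%N)%N%:Z - p%:Z.

Lemma xi0 p k l : xi p k 0 l = -1.
Proof. by rewrite /xi /repunit big_nil muln0 ltn0 mulr0 sub0r. Qed.

Lemma nu0 p k l : (l < p ^ k)%N -> nu p k 0 l = - p%:Z.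
Proof.
move=> lk; rewrite /nu big1 ?mulr0 ?sub0r // => e _.
by rewrite /repunit big_nil muln0 subn0 divn_small.
Qed.

(** Prefixing t and deleting the last digit of l leaves t followed by the j leading digits of l as
    the j+1 leading digits. *)
Lemma window_digits p k j t l : (0 < p)%N -> (j < k)%N ->
  ((p ^ k * t + l) %/ p %/ p ^ (k - j.+1) = p ^ j * t + l %/ p ^ (k - j))%N.
Proof.
move=> p0 jk; rewrite -divnMA -expnS subnSK //.
rewrite -{1}(subnKC (ltnW jk)) expnD -mulnA [(_ ^ (k - j) * _)%N]mulnC mulnA.
by rewrite divnMDl // expn_gt0 p0.
Qed.

Lemma digits_lt p k j l : (0 < p)%N -> (j <= k)%N -> (l < p ^ k)%N ->
  (l %/ p ^ (k - j) < p ^ j)%N.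
Proof. by move=> p0 jk lk; rewrite ltn_divLR ?expn_gt0 ?p0 // -expnD subnKC. Qed.

Lemma sum_window_lt p k l : odd p -> (1 < p)%N -> (l < p ^ k)%N ->
  2 * (\sum_(t < p) (p ^ k * t + l < (p - 1) %/ 2 * repunit p k.+1)%N)%N%:Z
  = p%:Z + xi p k k l.
Proof.
move=> p_odd p1 lk; rewrite sum_lt_repdigit // ?half_pred_lt //.
by rewrite /xi subnn divn1; lia.
Qed.

Lemma sum_rev_ord p : (2 * \sum_(e < p) (p - e.+1) = p * (p - 1))%N.
Proof.
rewrite (reindex_inj rev_ord_inj) /= (eq_bigr (fun e : 'I_p => e : nat)) => [|e _]; last first.
  by case: e => e ep /=; lia.
by rewrite -(big_mkord predT id) bin2_sum mulnC muln2 -[RHS]odd_double_half;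
   rewrite bin2 subn1 oddM; case: p => //= p; rewrite andNb.
Qed.

Lemma sum_window_gt p k l : (1 < p)%N -> (l < p ^ k)%N ->
  2 * (\sum_(t < p) \sum_(e < p) (e * repunit p k.+1 < p ^ k * t + l)%N)%N%:Z
  = p%:Z ^+ 2 + nu p k k l.
Proof.
move=> p1 lk; rewrite exchange_big /=.
rewrite (eq_bigr (fun e : 'I_p => p - e.+1 + (e * repunit p k < l)))%N => [|e _].
  rewrite big_split /= /nu subnn divn1.
  rewrite expr2; move: (sum_rev_ord p) (\sum_(e < p) (_ < l))%N => + n.
  by move: (\sum_(e < p) (p - _))%N => m; nia.
by rewrite sum_gt_repdigit.
Qed.

Lemma PoszX m n : (m ^ n)%N%:Z = m%:Z ^+ n.
Proof. by rewrite -!natz natrX. Qed.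

Lemma Posz_sum n (f : 'I_n -> nat) :
  (\sum_(t < n) f t)%N%:Z = \sum_(t < n) (f t)%:Z.
Proof. exact: (big_morph Posz PoszD). Qed.

(** The case t = e = (p-1)/2 hands down the indicator; the other digits contribute p-1 in all, and
    p-1-p = -1 restores the normalisation. *)
Lemma sum_xi p k j l : odd p -> (1 < p)%N -> (j < k)%N -> (l < p ^ k)%N ->
  \sum_(t < p) xi p k j.+1 ((p ^ k * t + l) %/ p) = xi p k j l.
Proof.
move=> p_odd p1 jk lk; have p0 := ltnW p1.
rewrite /xi sumrB -mulr_sumr sumr_const card_ord -Posz_sum.
under eq_bigr => t _ do rewrite window_digits //.
rewrite sum_lt_repdigit ?half_pred_lt ?digits_lt ?(ltnW jk) //.
move: (_ < _)%N => b; rewrite -mulr_natl natz; lia.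
Qed.

(** Twice the sum of the p-1-e is p(p-1), and p(p-1) - p^2 = -p restores the normalisation. *)
Lemma sum_nu p k j l : (1 < p)%N -> (j < k)%N -> (l < p ^ k)%N ->
  \sum_(t < p) nu p k j.+1 ((p ^ k * t + l) %/ p) = nu p k j l.
Proof.
move=> p1 jk lk; have p0 := ltnW p1.
rewrite /nu sumrB -mulr_sumr sumr_const card_ord -Posz_sum exchange_big /=.
rewrite (eq_bigr (fun e : 'I_p => p - e.+1 + (e * repunit p j < l %/ p ^ (k - j))))%N => [|e _].
  rewrite big_split /= -mulr_natl natz.
  move: (sum_rev_ord p) (\sum_(e < p) (_ < _ : nat))%N => + n.
  by move: (\sum_(e < p) (p - _))%N => m; nia.
under eq_bigr => t _ do rewrite window_digits //.
by rewrite sum_gt_repdigit ?digits_lt ?(ltnW jk).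
Qed.

(* The [m]-fold average of [f k], for a family [f] that averaging shifts down;
   exactly one of the two truncated subtractions [m - k], [k - m] can be nonzero. *)
Definition iter_avg (p k : nat) (f : nat -> nat -> int) m l : int :=
  p%:Z ^+ (m - k) * f (k - m)%N l.

(** Below k an average lowers the index; once the index is 0 the function is constant and an average
    multiplies it by p. *)
Lemma sum_iter_avg p k (f : nat -> nat -> int) c m l : (0 < p)%N -> (l < p ^ k)%N ->
  (forall j, (j < k)%N -> \sum_(t < p) f j.+1 ((p ^ k * t + l) %/ p)%N = f j l) ->
  (forall u, (u < p ^ k)%N -> f 0%N u = c) ->
  \sum_(t < p) iter_avg p k f m ((p ^ k * t + l) %/ p) = iter_avg p k f m.+1 l.
Proof.
move=> p0 lk favg f0; rewrite /iter_avg -mulr_sumr.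
have [mk|km] := ltnP m k.
  have -> : (m - k = 0)%N by lia.
  have -> : (m.+1 - k = 0)%N by lia.
  by rewrite -(favg (k - m.+1)%N) ?subnSK //; lia.
have -> : (k - m = 0)%N by lia.
have -> : (k - m.+1 = 0)%N by lia.
rewrite (eq_bigr (fun=> c)) => [|t _]; last by rewrite f0 // window_div_lt.
rewrite sumr_const card_ord f0 // subSn // exprS -mulr_natl natz.
by rewrite mulrCA mulrA.
Qed.

Lemma iter_avg0 p k f l : iter_avg p k f 0 l = f k l.
Proof. by rewrite /iter_avg sub0n subn0 mul1r. Qed.

(** * Closed form of the recursion *)

(** Up to powers of p, each round adds p + x_k and p^2 + n_k, and the m-th term is such a
    contribution averaged m times. The second sum is one shorter because 2 is never a descent. *)
Lemma Mfib_closed p k s l : odd p -> (1 < p)%N -> (l < p ^ k)%N ->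
  (Mfib p k (V s.+2 l))%:Z = ((p - 1) %/ 2)%N%:Z *
    (2 * s.+1%:Z * p%:Z ^+ s.+1
     + \sum_(m < s.+1) p%:Z ^+ (s - m) * iter_avg p k (xi p k) m l
     + \sum_(m < s) p%:Z ^+ (s - m.+1) * iter_avg p k (nu p k) m l).
Proof.
move=> p_odd p1; have p0 := ltnW p1.
have := @sum_window_lt p k _ p_odd p1.
have h2 : (p - 1)%N = (2 * ((p - 1) %/ 2))%N by lia.
have := @Mfib_V1 p k _ p1; have := fun s l => @Mfib_VS p k s l p_odd p1.
rewrite {1}h2; move: ((p - 1) %/ 2)%N h2 => h -> MS M1 lt_sum.
elim: s l => [|s IH] l lk.
  rewrite MS // Posz_sum.
  rewrite (eq_bigr (fun t : 'I_p => h%:Z + (2 * h)%:Z *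
     ((p ^ k * t + l < h * repunit p k.+1)%N : nat)%:Z)) => [|t _]; last first.
    by rewrite M1 ?window_div_lt // expn0 muln1 mul0n addn0 PoszD PoszM.
  rewrite big_split /= sumr_const card_ord -mulr_sumr -Posz_sum -mulr_natl natz.
  rewrite PoszM mulrAC -mulrA mulrCA mulrA [X in _ + X]mulrC.
  rewrite big_ord1 big_ord0 iter_avg0 subnn.
  move: (lt_sum l lk); move: (\sum_(t < p) _)%N => n E.
  transitivity (h%:Z * (p%:Z + 2 * n%:Z)); first by ring.
  by rewrite E; ring.
rewrite MS // Posz_sum.
pose M t := (Mfib p k (V s.+2 ((p ^ k * t + l) %/ p)))%:Z.
pose X t : int := ((p ^ k * t + l < h * repunit p k.+1)%N : nat)%:Z.
pose Y t := (\sum_(e < p) (e * repunit p k.+1 < p ^ k * t + l))%N%:Z.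
rewrite (eq_bigr (fun t : 'I_p => M t + (2 * h%:Z * p%:Z ^+ s.+1) * X t +
    (2 * h%:Z * p%:Z ^+ s) * Y t)) => [|t _]; last first.
  by rewrite mul1n subn2 /= !PoszD !PoszM !PoszX.
rewrite !big_split /= -!mulr_sumr.
have -> : \sum_(t < p) M t = h%:Z * (p%:Z * (2 * s.+1%:Z * p%:Z ^+ s.+1)
   + \sum_(m < s.+1) p%:Z ^+ (s - m) * iter_avg p k (xi p k) m.+1 l
   + \sum_(m < s) p%:Z ^+ (s - m.+1) * iter_avg p k (nu p k) m.+1 l).
  rewrite /M (eq_bigr _ (fun t _ => IH _ (window_div_lt (ltn_ord t) lk))).
  rewrite -mulr_sumr !big_split /= sumr_const card_ord -[_ *+ p]mulr_natl natz.
  congr (_ * (_ + _ + _)); rewrite exchange_big; apply: eq_bigr => m _ /=.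
    rewrite -mulr_sumr (@sum_iter_avg _ _ _ (-1)) // => [j jk|u uk].
      exact: sum_xi.
    exact: xi0.
  rewrite -mulr_sumr (@sum_iter_avg _ _ _ (- p%:Z)) // => [j jk|u uk].
    exact: sum_nu.
  exact: nu0.
(* The m = 0 terms are the contributions of the new round; the others come from the induction
   hypothesis. *)
rewrite -!Posz_sum [in RHS]big_ord_recl [\sum_(m < s.+1) _ * iter_avg _ _ (nu _ _) _ _]big_ord_recl.
rewrite !iter_avg0 subn0 subn1 /=; move: (lt_sum l lk) (sum_window_gt p1 lk).
move: (\sum_(t < p) _)%N (\sum_(t < p) _)%N => y x Ex Ey.
have {}Ex : xi p k k l = 2 * x%:Z - p%:Z by rewrite Ex; ring.
have {}Ey : nu p k k l = 2 * y%:Z - p%:Z ^+ 2 by rewrite Ey; ring.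
rewrite Ex Ey; under [in RHS]eq_bigr => m _ do rewrite /bump /= add1n subSS.
under [X in _ + (_ + X)]eq_bigr => m _ do rewrite /bump /= add1n subSS.
have -> : s.+2%:Z = s.+1%:Z + 1 :> int by rewrite -addn1 PoszD.
rewrite [p%:Z ^+ s.+2]exprS [p%:Z ^+ s.+1]exprS.
move: (\sum_(m < s.+1) _ : int) (\sum_(m < s) _ : int) (s.+1%:Z : int) => u v n.
by ring.
Qed.

(** The n+1 terms with m >= k all equal p^n c; the terms with m < k are reversed by j+1 = k-m. *)
Lemma sum_iter_avg_tail p k (f : nat -> nat -> int) c n l : f 0%N l = c ->
  \sum_(m < k + n.+1) p%:Z ^+ (k + n - m) * iter_avg p k f m l
  = p%:Z ^+ n * (\sum_(j < k) p%:Z ^+ j.+1 * f j.+1 l + n.+1%:Z * c).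
Proof.
move=> f0; rewrite big_split_ord /= mulrDr; congr (_ + _).
  rewrite (reindex_inj rev_ord_inj) /= mulr_sumr; apply: eq_bigr => j _.
  rewrite /iter_avg /= subKn //; have -> : (k - j.+1 - k = 0)%N by lia.
  rewrite mul1r mulrA -exprD; congr (_ ^+ _ * _).
  by case: j => j jk /=; lia.
rewrite (eq_bigr (fun=> p%:Z ^+ n * c)) => [|j _].
  by rewrite sumr_const card_ord -mulr_natl natz mulrCA.
rewrite /iter_avg /=; have -> : (k - (k + j) = 0)%N by lia.
rewrite f0 mulrA -exprD; congr (_ ^+ _ * _).
by case: j => j jk /=; lia.
Qed.

(** * The closed form in terms of thresholds on l *)

Definition tail (p k i : nat) := (\sum_(i <= j < k) p ^ j)%N.

(* [e * tail p k i] is the word of k - i digits e followed by i zeros, so the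
   summand says that l exceeds it already in its k - i leading digits. *)
Definition digit_rank (p k l i : nat) :=
  (\sum_(e < p) (e * tail p k i + p ^ i <= l))%N.

Lemma lt_repdigit_tail p k l j e : (0 < p)%N -> (j <= k)%N ->
  (e * repunit p j < l %/ p ^ (k - j))%N = (e * tail p k (k - j) + p ^ (k - j) <= l)%N.
Proof.
move=> p0 jk; rewrite leq_divRL ?expn_gt0 ?p0 // /tail sum_shift_repunit ?leq_subr //.
by rewrite subKn //; congr (_ <= _)%N; lia.
Qed.

Lemma le_repdigit_tail p k l j e : (0 < p)%N -> (j <= k)%N ->
  (e * repunit p j <= l %/ p ^ (k - j))%N = (e * tail p k (k - j) <= l)%N.
Proof.
move=> p0 jk; rewrite leq_divRL ?expn_gt0 ?p0 // /tail sum_shift_repunit ?leq_subr //.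
by rewrite subKn //; congr (_ <= _)%N; lia.
Qed.

(** Since s > k+2, both sums run past m = k. With s = k+r+3 and p^(r+1) factored out, their constant
    parts give -(r+2)-(r+1) = -2(s-k)+3. *)
Lemma Mfib_formula p k s l : odd p -> (1 < p)%N -> (k + 2 < s)%N -> (l < p ^ k)%N ->
  (Mfib p k (V s l))%:Z = ((p ^ (s - 2 - k) * (p - 1)) %/ 2)%N%:Z *
    ((2 * (s - 1) * p ^ k.+1)%N%:Z - (2 * (s - k))%N%:Z + 3
     + (2 * \sum_(0 <= j < k) p ^ j * digit_rank p k l (k - j.+1))%N%:Z
     - (2 * \sum_(0 <= j < k)
          p ^ j.+1 * ((p - 1) %/ 2 * tail p k (k - j.+1) <= l))%N%:Z).
Proof.
move=> p_odd p1 ks lk; have p0 := ltnW p1.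
have [r ->] : exists r, s = (k + r.+1).+2 by exists (s - k - 3)%N; lia.
rewrite Mfib_closed // -addnS (@sum_iter_avg_tail p k (xi p k) _ _ _ (xi0 p k l)).
rewrite [X in _ + X](eq_bigr (fun m : 'I_(k + r.+1) =>
  p%:Z ^+ (k + r - m) * iter_avg p k (nu p k) m l)) => [|m _]; last first.
  by congr (_ ^+ _ * _); case: m => m mk /=; lia.
rewrite (@sum_iter_avg_tail p k (nu p k) _ _ _ (nu0 lk)).
have -> : ((k + r.+2).+1 - 2 - k = r.+1)%N by lia.
have -> : ((k + r.+2).+1 - 1 = k + r.+2)%N by lia.
have -> : ((k + r.+2).+1 - k = r.+3)%N by lia.
have -> : ((p ^ r.+1 * (p - 1)) %/ 2 = p ^ r.+1 * ((p - 1) %/ 2))%N.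
  by rewrite muln_divA // dvdn2; lia.
rewrite !big_mkord; set h := ((p - 1) %/ 2)%N.
set N := (\sum_(j < k) _ * digit_rank _ _ _ _)%N; set Y := (\sum_(j < k) _ * (_ <= _))%N.
(* Written as 1 - 2[h R_j <= u_j], x_j has constant 1, and p times it cancels the -p of n_j. *)
have E : p%:Z * (\sum_(j < k) p%:Z ^+ j.+1 * xi p k j.+1 l) +
    \sum_(j < k) p%:Z ^+ j.+1 * nu p k j.+1 l = p%:Z * (2 * N%:Z - 2 * Y%:Z).
  rewrite /N /Y !Posz_sum !mulr_sumr -sumrB mulr_sumr -big_split /=.
  apply: eq_bigr => j _; rewrite /xi /nu -/h !PoszM !PoszX.
  rewrite ltnNge le_repdigit_tail //.
  under eq_bigr => e _ do rewrite lt_repdigit_tail //.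
  rewrite -/(digit_rank _ _ _ _) exprS; case: (_ <= l)%N; rewrite /=; ring.
rewrite !PoszM !PoszX.
have -> : r.+3%:Z = r%:Z + 3 by rewrite -addn3 PoszD.
have -> : r.+2%:Z = r%:Z + 2 by rewrite -addn2 PoszD.
have -> : (k + r.+2)%N%:Z = k%:Z + r%:Z + 2 by lia.
have -> : r.+1%:Z = r%:Z + 1 by rewrite -addn1 PoszD.
have -> : (k + r.+2 = r.+1 + k.+1)%N by lia.
rewrite exprD exprS.
move: E; move: (\sum_(j < k) _ : int) (\sum_(j < k) _ : int) => v u E.
have -> : v = p%:Z * (2 * N%:Z - 2 * Y%:Z) - p%:Z * u by rewrite -E; ring.
ring.
Qed.

Local Close Scope ring_scope.

(** * Evaluating digit ranks and indicators *)

Lemma tail0 p k : tail p k 0 = repunit p k. Proof. by []. Qed.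

Lemma tail_recl p k i : i < k -> tail p k i = p ^ i + tail p k i.+1.
Proof. by move=> ik; rewrite /tail big_ltn. Qed.

Lemma tail_pred p k : 0 < k -> tail p k k.-1 = p ^ k.-1.
Proof. by move=> k0; rewrite tail_recl ?ltn_predL // /tail prednK // big_geq ?addn0. Qed.

Lemma tail_antimono p k i j : i <= j -> j <= k -> tail p k j <= tail p k i.
Proof. by move=> ij jk; rewrite /tail (big_cat_nat ij jk) leq_addl. Qed.

(** Raising i by one changes the threshold by p^i(p-1-e) >= 0. *)
Lemma threshold_mono p k e i j : e < p -> i <= j -> j <= k ->
  e * tail p k i + p ^ i <= e * tail p k j + p ^ j.
Proof.
move=> ep; elim: j => [|j IH]; first by rewrite leqn0 => /eqP ->.
rewrite leq_eqVlt => /orP[/eqP -> // | ij] jk.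
apply: leq_trans (IH ij (ltnW jk)) _.
rewrite (tail_recl p jk) expnS; nia.
Qed.

Lemma threshold_le p k e i : e < p -> i < k ->
  e * tail p k i + p ^ i <= e.+1 * p ^ k.-1.
Proof.
move=> ep ik; have k0 : 0 < k by lia.
apply: (leq_trans (threshold_mono ep (j := k.-1) _ _)); rewrite ?leq_pred //; first by lia.
by rewrite tail_pred // mulSn addnC.
Qed.

Lemma pow_le_tail p k i : i < k -> p ^ k.-1 <= tail p k i.
Proof.
move=> ik; have k0 : 0 < k by lia.
by rewrite -tail_pred // tail_antimono ?leq_pred //; lia.
Qed.

(** The thresholds increase with e, so the rank is read off from the two that enclose l; there is no
    lower one if t = 0. *)
Lemma digit_rank_eq p k l i t : t < p ->
  (0 < t -> t.-1 * tail p k i + p ^ i <= l) -> l < t * tail p k i + p ^ i ->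
  digit_rank p k l i = t.
Proof.
move=> tp lo hi; rewrite -[RHS](sum_ord_lt (ltnW tp)); apply: eq_bigr => e _.
congr nat_of_bool; have [et|te] := ltnP e t.
  have /lo := leq_ltn_trans (leq0n e) et; apply: leq_trans.
  by rewrite leq_add2r leq_mul2r; apply/orP; right; lia.
apply/negbTE; rewrite -ltnNge; apply: leq_trans hi _.
by rewrite leq_add2r leq_mul2r te orbT.
Qed.

Lemma sum_pow_const p k c : \sum_(0 <= j < k) p ^ j * c = c * repunit p k.
Proof. by rewrite /repunit big_distrr /=; apply: eq_bigr => j _; rewrite mulnC. Qed.

Lemma sum_pow_if p k n : n <= k ->
  \sum_(0 <= j < k) p ^ j * (j < n) = \sum_(0 <= j < n) p ^ j.
Proof.
move=> nk; rewrite (big_cat_nat (leq0n n) nk) /=.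
rewrite [X in _ + X]big_nat_cond [X in _ + X]big1 => [|j]; last first.
  by move=> /andP[/andP[nj _] _]; rewrite ltnNge nj muln0.
by rewrite addn0; apply: eq_big_nat => j /andP[_ ->]; rewrite muln1.
Qed.

Lemma sum_powS p a b : \sum_(a.+1 <= j < b.+1) p ^ j = \sum_(a <= j < b) p ^ j.+1.
Proof. by rewrite big_add1. Qed.

Lemma sum_digit_rank_const p k l t : (forall i, i < k -> digit_rank p k l i = t) ->
  \sum_(0 <= j < k) p ^ j * digit_rank p k l (k - j.+1) = t * repunit p k.
Proof.
move=> rk; rewrite -sum_pow_const; apply: eq_big_nat => j /andP[_ jk].
by rewrite rk //; lia.
Qed.

(** The threshold at i = 0 is the largest. *)
Lemma sum_ind_all p k l h : h * tail p k 0 <= l ->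
  \sum_(0 <= j < k) p ^ j.+1 * (h * tail p k (k - j.+1) <= l) = p * repunit p k.
Proof.
move=> hl; rewrite /repunit big_distrr /=; apply: eq_big_nat => j /andP[_ jk].
rewrite expnS (leq_trans _ hl) ?muln1 // leq_mul2l tail_antimono ?orbT //.
exact: leq_subr.
Qed.

(** The threshold at i = k-1, namely h p^(k-1), is the smallest. *)
Lemma sum_ind_none p k l h : l < h * p ^ k.-1 ->
  \sum_(0 <= j < k) p ^ j.+1 * (h * tail p k (k - j.+1) <= l) = 0.
Proof.
move=> hl; rewrite big_nat big1 // => j /andP[_ jk].
rewrite leqNgt (leq_trans hl) ?muln0 // leq_mul2l pow_le_tail ?orbT //; lia.
Qed.

(** * The five cases *)

Local Open Scope ring_scope.

Theorem mainTheorem8 (p k s l : nat) :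
  prime p -> odd p -> (2 <= k)%N -> (k + 2 < s)%N -> (l < p ^ k)%N ->
  let M : int := (Mfib p k (V s l))%:Z in
  let Ssum : int := (\sum_(0 <= j < k) p ^ j)%N%:Z in
  let A : int := (2 * (s - 1) * p ^ k.+1)%N%:Z - (2 * (s - k))%N%:Z + 3 in
  let c : int := ((p ^ (s - 2 - k) * (p - 1)) %/ 2)%N%:Z in
  (* (a) *)
  (l = 0%N -> M = c * A) /\
  (* (b) *)
  (forall i t : nat, (i <= k - 2)%N -> (1 <= t <= p - 1)%N ->
     ((t - 1) * (\sum_(i <= j < k) p ^ j) + p ^ i <= l)%N ->
     (l <= (t - 1) * (\sum_(i.+1 <= j < k) p ^ j) + p ^ i.+1 - 1)%N ->
     ((t <= (p - 1) %/ 2)%N ->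
        M = c * (A + (2 * t)%N%:Z * Ssum - (2 * \sum_(0 <= mu < k - i - 1) p ^ mu)%N%:Z)) /\
     (((p + 1) %/ 2 <= t)%N ->
        M = c * (A + ((2 * t)%N%:Z - (2 * p)%N%:Z) * Ssum
                   - (2 * \sum_(0 <= mu < k - i - 1) p ^ mu)%N%:Z))) /\
  (* (c) *)
  (forall t : nat, (1 <= t <= p - 1)%N -> t <> ((p - 1) %/ 2)%N ->
     (t * p ^ k.-1 <= l <= t * \sum_(0 <= j < k) p ^ j)%N ->
     ((t <= (p - 3) %/ 2)%N -> M = c * (A + (2 * t)%N%:Z * Ssum)) /\
     (((p + 1) %/ 2 <= t)%N -> M = c * (A + ((2 * t)%N%:Z - (2 * p)%N%:Z) * Ssum))) /\
  (* (d) *)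
  (forall i' : nat, (1 <= i' <= k - 1)%N ->
     ((p - 1) %/ 2 * (\sum_(i' <= j < k) p ^ j) <= l)%N ->
     (l <= (p - 1) %/ 2 * (\sum_(i'.-1 <= j < k) p ^ j) - 1)%N ->
     M = c * (A - (p ^ k)%N%:Z - (2 * \sum_(1 <= th < k) p ^ th)%N%:Z
                + (2 * \sum_(k - i' + 1 <= mu < k.+1) p ^ mu)%N%:Z - 1)) /\
  (* (e) *)
  (l = ((p - 1) %/ 2 * \sum_(0 <= j < k) p ^ j)%N ->
     M = c * (A - (p ^ k)%N%:Z - (2 * \sum_(1 <= th < k) p ^ th)%N%:Z - 1)).
Proof.
move=> p_prime p_odd k2 ks lk M Ssum A c.
have p1 := prime_gt1 p_prime; have p0 := ltnW p1.
have ME : M = c * (A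
     + (2 * \sum_(0 <= j < k) p ^ j * digit_rank p k l (k - j.+1))%N%:Z
     - (2 * \sum_(0 <= j < k)
          p ^ j.+1 * ((p - 1) %/ 2 * tail p k (k - j.+1) <= l))%N%:Z).
  exact: Mfib_formula.
have h2 : (p - 1 = 2 * ((p - 1) %/ 2))%N by lia.
have h0 : (0 < (p - 1) %/ 2)%N by lia.
have hp := half_pred_lt p1.
have -> : ((p + 1) %/ 2 = ((p - 1) %/ 2).+1)%N by lia.
have -> : ((p - 3) %/ 2 = ((p - 1) %/ 2).-1)%N by lia.
have R2 := repunit_pred k p0.
have k0 : (0 < k)%N by lia.
have pk1 : (0 < p ^ k.-1)%N by rewrite expn_gt0 p0.
rewrite {}ME {M}; move: ((p - 1) %/ 2)%N h2 h0 hp => h h2 h0 hp.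
(* Every [l] in the ranges of (c), (d) and (e) has constant digit rank. *)
have rank_const t : (0 < t < p)%N -> (t * p ^ k.-1 <= l)%N -> (l <= t * repunit p k)%N ->
    forall i, (i < k)%N -> digit_rank p k l i = t.
  move=> /andP[t0 tp] lo hi i ik; apply: digit_rank_eq => // [_|].
    by apply: leq_trans lo; have := @threshold_le p k t.-1 i; rewrite prednK //; lia.
  have := threshold_mono tp (leq0n i) (ltnW ik).
  by rewrite tail0 expn0; lia.
have sum1 : (\sum_(1 <= th < k.+1) p ^ th = p * repunit p k)%N.
  by rewrite sum_powS /repunit big_distrr; apply: eq_bigr => j _; rewrite expnS.
have sum1r : (\sum_(1 <= th < k.+1) p ^ th = \sum_(1 <= th < k) p ^ th + p ^ k)%N.
  by rewrite big_nat_recr.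
split; [|split; [|split; [|split]]].
- move=> l0; rewrite (@sum_digit_rank_const _ _ _ 0) ?mul0n; last first.
    by move=> i ik; apply: digit_rank_eq; rewrite // l0 mul0n expn_gt0 p0.
  by rewrite sum_ind_none ?l0 ?muln_gt0 ?h0 // muln0 addr0 subr0.
- move=> i t ik /andP[t0 tp1]; rewrite -/(tail p k i) -/(tail p k i.+1) => lo hi.
  have tp : (t < p)%N by lia.
  have {}hi : (l < (t - 1) * tail p k i.+1 + p ^ i.+1)%N.
    have := expn_gt0 p i.+1; rewrite p0 => /= pi0.
    move: pi0 hi; move: (p ^ i.+1)%N ((t - 1) * _)%N => x y; lia.
  have lt : (l < t * p ^ k.-1)%N.
    apply: leq_trans hi _; have := @threshold_le p k (t - 1) i.+1.
    by rewrite subn1 prednK //; lia.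
  have tl : (t.-1 * p ^ k.-1 <= l)%N.
    apply: leq_trans lo; rewrite subn1 (leq_trans _ (leq_addr _ _)) //.
    by rewrite leq_mul2l pow_le_tail ?orbT //; lia.
  (* The bounds on l are the thresholds of digit t-1 at i and i+1, so the rank drops from t to t-1
     exactly after i. *)
  have rank_hi j : (j <= i)%N -> digit_rank p k l j = t.
    move=> ji; apply: digit_rank_eq => // [_|].
      apply: leq_trans lo; rewrite -subn1; apply: threshold_mono; lia.
    apply: leq_trans lt _; rewrite (leq_trans _ (leq_addr _ _)) //.
    by rewrite leq_mul2l pow_le_tail ?orbT //; lia.
  have rank_lo j : (i < j)%N -> (j < k)%N -> digit_rank p k l j = t.-1.
    move=> ij jk; apply: digit_rank_eq => [|t1|]; first by lia.
      by apply: leq_trans tl; have := @threshold_le p k t.-2 j; rewrite prednK //; lia.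
    rewrite -subn1; apply: leq_trans hi _; apply: threshold_mono; lia.
  have rank_sum : (\sum_(0 <= j < k) p ^ j * digit_rank p k l (k - j.+1)
      + \sum_(0 <= mu < k - i - 1) p ^ mu = t * repunit p k)%N.
    rewrite -(@sum_pow_if p k (k - i - 1)); last by lia.
    rewrite -sum_pow_const -big_split /=; apply: eq_big_nat => j /andP[_ jk].
    rewrite -mulnDr; congr (_ * _)%N; have [jl|jl] := ltnP j (k - i - 1).
      by rewrite rank_lo; lia.
    by rewrite rank_hi; lia.
  have rank_sumZ : (\sum_(0 <= j < k) p ^ j * digit_rank p k l (k - j.+1))%N%:Z
      = t%:Z * Ssum - (\sum_(0 <= mu < k - i - 1) p ^ mu)%N%:Z.
    by rewrite -[Ssum]/((repunit p k)%:Z) -PoszM -rank_sum PoszD addrK.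
  (* For t <= h no indicator holds; for t > h all of them do and contribute -2pS. *)
  split=> th; rewrite !PoszM rank_sumZ.
    rewrite sum_ind_none; first by ring.
    by apply: leq_trans lt _; rewrite leq_mul2r th orbT.
  rewrite sum_ind_all ?PoszM -?[(repunit p k)%:Z]/Ssum; first by ring.
  apply: leq_trans lo.
  have := @threshold_mono p k h 0 i hp (leq0n i).
  rewrite expn0 => /(_ ltac:(lia)).
  have : (h * tail p k i <= (t - 1) * tail p k i)%N by rewrite leq_mul2r; lia.
  lia.
- move=> t /andP[t0 tp1] tn /andP[lo hi]; have tp : (t < p)%N by lia.
  rewrite (sum_digit_rank_const (rank_const t _ lo hi)); last by rewrite t0.
  (* If t < h then l <= tS < (t+1)p^(k-1) <= h p^(k-1); if t > h then hS < (h+1)p^(k-1) <= l. *)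
  split=> th; rewrite !PoszM -?[(repunit p k)%:Z]/Ssum.
    rewrite sum_ind_none; first by ring.
    apply: (leq_ltn_trans hi); rewrite -/(repunit p k) -tail0.
    have := @threshold_le p k t 0 tp k0.
    have : (t.+1 * p ^ k.-1 <= h * p ^ k.-1)%N by rewrite leq_mul2r; apply/orP; right; lia.
    by rewrite expn0; lia.
  rewrite sum_ind_all ?PoszM -?[(repunit p k)%:Z]/Ssum; first by ring.
  apply: leq_trans lo.
  have := @threshold_le p k h 0 hp k0.
  have : (h.+1 * p ^ k.-1 <= t * p ^ k.-1)%N by rewrite leq_mul2r th orbT.
  by lia.
- move=> i /andP[i0 ik]; rewrite -/(tail p k i) -/(tail p k i.-1) => lo hi.
  have {}hi : (l < h * tail p k i.-1)%N.
    have := @pow_le_tail p k i.-1; nia.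
  have lo' : (h * p ^ k.-1 <= l)%N.
    by apply: leq_trans lo; rewrite leq_mul2l pow_le_tail ?orbT //; lia.
  have hi' : (l <= h * repunit p k)%N.
    apply: ltnW; apply: leq_trans hi _; rewrite -tail0 leq_mul2l tail_antimono ?orbT //; lia.
  rewrite (sum_digit_rank_const (rank_const h _ lo' hi')); last by rewrite h0.
  (* The bounds on l are h times the tails at i and i-1, so exactly the indices j < k-i count. *)
  have -> : (\sum_(0 <= j < k) p ^ j.+1 * (h * tail p k (k - j.+1) <= l)
             = \sum_(1 <= j < k - i + 1) p ^ j)%N.
    rewrite addn1 sum_powS.
    transitivity (p * \sum_(0 <= j < k) p ^ j * (j < k - i))%N.
      rewrite big_distrr; apply: eq_big_nat => j /andP[_ jk] /=.
      rewrite expnS mulnA; congr (_ * nat_of_bool _)%N.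
      have [jl|jl] := ltnP j (k - i).
        by apply: leq_trans lo; rewrite leq_mul2l tail_antimono ?orbT //; lia.
      apply/negbTE; rewrite -ltnNge; apply: leq_trans hi _.
      by rewrite leq_mul2l tail_antimono ?orbT //; lia.
    rewrite sum_pow_if ?leq_subr // big_distrr; apply: eq_bigr => j _.
    by rewrite expnS.
  (* The stated form takes the complementary powers of p; 2hS = p^k - 1 accounts for the rest. *)
  have := @big_cat_nat _ 0%N addn (k - i + 1)%N 1%N k.+1 predT (fun j => p ^ j)%N.
  move=> /(_ ltac:(lia) ltac:(lia)); rewrite sum1r /= => sumd.
  rewrite h2 in R2; congr (_ * _); lia.
- move=> lE; have lE' : l = (h * repunit p k)%N by [].
  have lo : (h * p ^ k.-1 <= l)%N.
    by rewrite lE' leq_mul2l -tail0 pow_le_tail ?orbT.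
  have hi : (l <= h * repunit p k)%N by rewrite lE'.
  rewrite (sum_digit_rank_const (rank_const h _ lo hi)); last by rewrite h0.
  (* All indicators hold, and again 2hS = p^k - 1. *)
  rewrite sum_ind_all ?tail0 -?sum1 ?sum1r ?lE' //.
  rewrite h2 in R2; congr (_ * _); lia.
Qed.
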